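(* Let $\mathfrak S\subseteq\mathcal P(\Delta)$ be an adapted structure and let $M$ be a non-deterministic $\lambda$-term typable in System $\mathcal D_+$ (i.e. $\Gamma\vdash M:B$ is derivable for some context $\Gamma$ and type $B$). Then $\mathcal T(M)\in\mathfrak S$.
   Context: Non-deterministic $\lambda$-terms are given by $M::=x\mid\lambda x.M\mid (M)N\mid M+N$, taken up to $\alpha$-equivalence and the identities $M+N=N+M$, $(M+N)+P=M+(N+P)$, $\lambda x.(M+N)=\lambda x.M+\lambda x.N$, $(M+N)P=(M)P+(N)P$. System $\mathcal D_+$. Types are $A::=X\mid A\to B\mid A\cap B$. The subtyping relation $\le$ is the least reflexive and transitive relation closed under: $A_1\cap A_2\le A_i$; if $A'\le A$ and $B\le B'$ then $A\to B\le A'\to B'$; $(A\to B)\cap(A\to C)\le A\to(B\cap C)$. The typing rules are: - $\Gamma,x:A\vdash x:A$; - from $\Gamma,x:A\vdash M:B$ infer $\Gamma\vdash\lambda x.M:A\to B$; - from $\Gamma\vdash M:A\to B$ and $\Gamma\vdash N:A$ infer $\Gamma\vdash (M)N:B$; - from $\Gamma\vdash M:A$ and $\Gamma\vdash M:B$ infer $\Gamma\vdash M:A\cap B$; - from $\Gamma\vdash M:A$ and $\Gamma\vdash N:A$ infer $\Gamma\vdash M+N:A$; - from $\Gamma\vdash M:A$ and $A\le A'$ infer $\Gamma\vdash M:A'$. Resource terms $\Delta$ are given by $s::=x\mid\lambda x.s\mid\langle s\rangle\bar t$, where bags $\bar t=[t_1,\dots,t_n]$ ($n\ge 0$) are finite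 multisets of resource terms. We write $\langle s\rangle\bar t_1\cdots\bar t_n$ for $\langle\cdots\langle s\rangle\bar t_1\cdots\rangle\bar t_n$. For $a\subseteq\Delta$, $a^!$ is the set of bags with all elements in $a$. The Taylor support $\mathcal T(M)$ is defined by: - $\mathcal T(x)=\{x\}$; - $\mathcal T(\lambda x.M)=\{\lambda x.s:s\in\mathcal T(M)\}$; - $\mathcal T((M)N)=\{\langle s\rangle\bar t:s\in\mathcal T(M),\bar t\in\mathcal T(N)^!\}$; - $\mathcal T(M+N)=\mathcal T(M)\cup\mathcal T(N)$. For $t\in\Delta$ and a bag $\bar s=[s_1,\dots,s_n]$, let $t\langle\bar s/x\rangle$ be the set of terms obtained by replacing bijectively the free occurrences of $x$ in $t$ by $s_1,\dots,s_n$. This set is empty unless $x$ has exactly $n$ free occurrences in $t$. For $e,a\subseteq\Delta$ let $e\langle a^!/x\rangle=\bigcup_{t\in e,\bar s\in a^!}t\langle\bar s/x\rangle$. For $f,a_1,\dots,a_n\subseteq\Delta$ let $\langle f\rangle a_1^!\cdots a_n^!=\{\langle s\rangle\bar t_1\cdots\bar t_n: s\in f,\bar t_i\in a_i^!\}$. A structure is a subset of $\mathcal P(\Delta)$. For structures $\mathfrak S,\mathfrak S'$: - $\mathfrak S\to\mathfrak S'=\{f\subseteq\Delta:\forall a\in\mathfrak S,\ \langle f\rangle a^!\in\mathfrak S'\}$. - $\mathfrak S'$ is $\mathfrak S$-saturated if for all $e,f_0,\dots,f_n\in\mathfrak S$, $\langle e\langle f_0^!/x\rangle\rangle f_1^!\cdots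 f_n^!\in\mathfrak S'$ implies $\langle\lambda x.e\rangle f_0^!f_1^!\cdots f_n^!\in\mathfrak S'$. - $\mathcal N(\mathfrak S)=\{\{x\}:x\text{ a variable}\}\cup\{\langle x\rangle a_1^!\cdots a_n^!: x\text{ a variable},\ n>0,\ a_i\in\mathfrak S\}$. - $\mathfrak S$ is adapted if: (1) $\mathfrak S$ is $\mathfrak S$-saturated; (2) $\mathcal N(\mathfrak S)\subseteq(\mathfrak S\to\mathcal N(\mathfrak S))\subseteq(\mathcal N(\mathfrak S)\to\mathfrak S)\subseteq\mathfrak S$; (3) $b\cup b'\in\mathfrak S$ for all $b,b'\in\mathfrak S$.
   Formalization: In saturation, bound names are chosen per element of e, and ''e in S'' is required under every name x; so saturation also applies when λx.e has all variables free. With one fixed name x the claim fails: some adapted S omits T(λx.λy.x). *)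

(* Defs.v *)
From Stdlib Require List.
From HB Require Import structures.
From mathcomp Require Import all_boot.
From mathcomp Require Import generic_quotient.
From mathcomp Require Import boolp classical_sets.

Set Implicit Arguments.
Unset Strict Implicit.
Unset Printing Implicit Defensive.

Local Open Scope quotient_scope.
Local Open Scope classical_set_scope.

(* Variables are natural numbers.  Both calculi are written with de Bruijn
   indices, which takes care of alpha-equivalence: an index i occurring under
   d binders is bound if i < d, and is the free variable i - d otherwise. *)
Notation var := nat.

(* Non-deterministic terms *)

Inductive preterm : Type :=
| PVar of var
| PLam of preterm
| PApp of preterm & preterm
| PAdd of preterm & preterm.

HB.instance Definition _ := gen_eqMixin preterm.
HB.instance Definition _ := gen_choiceMixin preterm.

Inductive preterm_eq : preterm -> preterm -> Prop :=
| PEaddC M N : preterm_eq (PAdd M N) (PAdd N M)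
| PEaddA M N P : preterm_eq (PAdd (PAdd M N) P) (PAdd M (PAdd N P))
| PElamD M N : preterm_eq (PLam (PAdd M N)) (PAdd (PLam M) (PLam N))
| PEappD M N P : preterm_eq (PApp (PAdd M N) P) (PAdd (PApp M P) (PApp N P))
| PElam M M' : preterm_eq M M' -> preterm_eq (PLam M) (PLam M')
| PEapp M M' N N' : preterm_eq M M' -> preterm_eq N N' ->
    preterm_eq (PApp M N) (PApp M' N')
| PEadd M M' N N' : preterm_eq M M' -> preterm_eq N N' ->
    preterm_eq (PAdd M N) (PAdd M' N')
| PErefl M : preterm_eq M M
| PEsym M N : preterm_eq M N -> preterm_eq N M
| PEtrans M N P : preterm_eq M N -> preterm_eq N P -> preterm_eq M P.

Definition preterm_eqb (M N : preterm) : bool := `[< preterm_eq M N >].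

Lemma preterm_eqb_refl : reflexive preterm_eqb.
Proof. by move=> M; apply/asboolP/PErefl. Qed.

Lemma preterm_eqb_sym : symmetric preterm_eqb.
Proof. by move=> M N; apply/asboolP/asboolP => /PEsym. Qed.

Lemma preterm_eqb_trans : transitive preterm_eqb.
Proof.
by move=> N M P /asboolP MN /asboolP NP; apply/asboolP/(PEtrans MN NP).
Qed.

Canonical preterm_equiv :=
  EquivRel preterm_eqb preterm_eqb_refl preterm_eqb_sym preterm_eqb_trans.

Definition term := {eq_quot preterm_equiv}.
HB.instance Definition _ := Choice.on term.
HB.instance Definition _ := EqQuotient.on term.

Definition TVar (x : var) : term := \pi_term (PVar x).
Definition TLam (M : term) : term := \pi_term (PLam (repr M)).
Definition TApp (M N : term) : term := \pi_term (PApp (repr M) (repr N)).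
Definition TAdd (M N : term) : term := \pi_term (PAdd (repr M) (repr N)).

(* System D+ *)

Inductive ty : Type :=
| TyAtom of nat
| TyArr of ty & ty
| TyCap of ty & ty.

Inductive subty : ty -> ty -> Prop :=
| SubRefl A : subty A A
| SubTrans A B C : subty A B -> subty B C -> subty A C
| SubCapL A1 A2 : subty (TyCap A1 A2) A1
| SubCapR A1 A2 : subty (TyCap A1 A2) A2
| SubArr A A' B B' : subty A' A -> subty B B' ->
    subty (TyArr A B) (TyArr A' B')
| SubArrCap A B C :
    subty (TyCap (TyArr A B) (TyArr A C)) (TyArr A (TyCap B C)).

(* The i-th type of the context is that of the variable i. *)
Inductive typing : seq ty -> term -> ty -> Prop :=
| TypVar G x A : onth G x = Some A -> typing G (TVar x) A
| TypLam G M A B : typing (A :: G) M B -> typing G (TLam M) (TyArr A B)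
| TypApp G M N A B : typing G M (TyArr A B) -> typing G N A ->
    typing G (TApp M N) B
| TypCap G M A B : typing G M A -> typing G M B -> typing G M (TyCap A B)
| TypAdd G M N A : typing G M A -> typing G N A -> typing G (TAdd M N) A
| TypSub G M A A' : typing G M A -> subty A A' -> typing G M A'.

Definition typable (M : term) : Prop := exists G B, typing G M B.

(* Resource terms *)

Inductive preres : Type :=
| PRVar of var
| PRLam of preres
| PRApp of preres & seq preres.

HB.instance Definition _ := gen_eqMixin preres.
HB.instance Definition _ := gen_choiceMixin preres.

(* Permutations of bags, at any depth. *)
Inductive preres_eq : preres -> preres -> Prop :=
| PREperm s ts ts' : perm_eq ts ts' -> preres_eq (PRApp s ts) (PRApp s ts')
| PRElam s s' : preres_eq s s' -> preres_eq (PRLam s) (PRLam s')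
| PREfun s s' ts : preres_eq s s' -> preres_eq (PRApp s ts) (PRApp s' ts)
| PREarg s t t' ts : preres_eq t t' ->
    preres_eq (PRApp s (t :: ts)) (PRApp s (t' :: ts))
| PRErefl s : preres_eq s s
| PREsym s t : preres_eq s t -> preres_eq t s
| PREtrans s t u : preres_eq s t -> preres_eq t u -> preres_eq s u.

Definition preres_eqb (s t : preres) : bool := `[< preres_eq s t >].

Lemma preres_eqb_refl : reflexive preres_eqb.
Proof. by move=> s; apply/asboolP/PRErefl. Qed.

Lemma preres_eqb_sym : symmetric preres_eqb.
Proof. by move=> s t; apply/asboolP/asboolP => /PREsym. Qed.

Lemma preres_eqb_trans : transitive preres_eqb.
Proof.
by move=> t s u /asboolP st /asboolP tu; apply/asboolP/(PREtrans st tu).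
Qed.

Canonical preres_equiv :=
  EquivRel preres_eqb preres_eqb_refl preres_eqb_sym preres_eqb_trans.

Definition res := {eq_quot preres_equiv}.
HB.instance Definition _ := Choice.on res.
HB.instance Definition _ := EqQuotient.on res.

(* Bags are given by enumerations; RApp identifies the enumerations of a
   bag, see RApp_perm. *)
Definition RVar (x : var) : res := \pi_res (PRVar x).
Definition RLam (s : res) : res := \pi_res (PRLam (repr s)).
Definition RApp (s : res) (ts : seq res) : res :=
  \pi_res (PRApp (repr s) (map repr ts)).

Lemma RApp_perm s ts ts' : perm_eq ts ts' -> RApp s ts = RApp s ts'.
Proof. by move=> p; apply/eqmodP/asboolP/PREperm/perm_map. Qed.

Lemma RLam_pi s : RLam (\pi_res s) = \pi_res (PRLam s).
Proof.
apply/eqmodP/asboolP/PRElam; apply/asboolP.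
by move: (reprK (\pi_res s)) => /eqmodP.
Qed.

Lemma RApp_pi s ts : RApp (\pi_res s) (map \pi_res ts) = \pi_res (PRApp s ts).
Proof.
have rK t : preres_eq (repr (\pi_res t)) t.
  by apply/asboolP; move: (reprK (\pi_res t)) => /eqmodP.
apply/eqmodP/asboolP/(PREtrans (PREfun _ (rK s))); rewrite -map_comp.
suff H us : preres_eq (PRApp s (map (repr \o \pi_res) ts ++ us))
                      (PRApp s (ts ++ us)).
  by move: (H [::]); rewrite !cats0.
elim: ts us => [|t ts IH] us /=; first exact: PRErefl.
apply: PREtrans (PREarg _ _ (rK t)) _.
have swap vs : perm_eq (t :: vs ++ us) (vs ++ t :: us).
  by rewrite -(cat1s t us) -cat1s perm_catCA.
apply: PREtrans (PREperm _ (swap _)) _.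
by apply: PREtrans (IH _) _; apply: PREperm; rewrite perm_sym swap.
Qed.

(* The sets of bags with all elements in a. *)
Definition bang (a : set res) : set (seq res) := [set ts | List.Forall a ts].

Definition lam_set (e : set res) : set res := [set RLam s | s in e].

Definition app_set (f a : set res) : set res :=
  [set RApp s ts | s in f & ts in bang a].

(* <f> a_1^! ... a_n^! *)
Definition apps_set (f : set res) (a : seq (set res)) : set res :=
  foldl app_set f a.

(* Taylor support *)

Fixpoint pretaylor (M : preterm) : set res :=
  match M with
  | PVar x => [set RVar x]
  | PLam M => lam_set (pretaylor M)
  | PApp M N => app_set (pretaylor M) (pretaylor N)
  | PAdd M N => pretaylor M `|` pretaylor N
  end.

Lemma pretaylor_eq M N : preterm_eq M N -> pretaylor M = pretaylor N.
Proof.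
elim=> //= {M N}.
- by move=> M N; rewrite setUC.
- by move=> M N P; rewrite setUA.
- by move=> M N; rewrite /lam_set image_setU.
- move=> M N P; apply/seteqP; split=> t.
    by move=> [s [sM|sN] [ts tsP <-]]; [left|right]; exists s => //; exists ts.
  by move=> [] [s sM [ts tsP <-]]; exists s; [left| |right|] => //; exists ts.
- by move=> M M' _ ->.
- by move=> M M' N N' _ -> _ ->.
- by move=> M M' N N' _ -> _ ->.
- by move=> M N P _ -> _ ->.
Qed.

Definition taylor (M : term) : set res := pretaylor (repr M).

Lemma taylor_pi M : taylor (\pi_term M) = pretaylor M.
Proof.
by apply/pretaylor_eq/asboolP; move: (reprK (\pi_term M)) => /eqmodP.
Qed.

Lemma taylor_var x : taylor (TVar x) = [set RVar x].
Proof. exact: taylor_pi. Qed.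

Lemma taylor_lam M : taylor (TLam M) = lam_set (taylor M).
Proof. exact: taylor_pi. Qed.

Lemma taylor_app M N : taylor (TApp M N) = app_set (taylor M) (taylor N).
Proof. exact: taylor_pi. Qed.

Lemma taylor_add M N : taylor (TAdd M N) = taylor M `|` taylor N.
Proof. exact: taylor_pi. Qed.

(* Linear substitution *)

Fixpoint preshift (k : nat) (s : preres) : preres :=
  match s with
  | PRVar i => PRVar (bump k i)
  | PRLam s => PRLam (preshift k.+1 s)
  | PRApp s ts => PRApp (preshift k s) (map (preshift k) ts)
  end.

Definition shift (k : nat) (s : res) : res := \pi_res (preshift k (repr s)).

Lemma preshift_eq k s t :
  preres_eq s t -> preres_eq (preshift k s) (preshift k t).
Proof.
move=> st; elim: st k => {s t} /=.
- by move=> s ts ts' p k; apply/PREperm/perm_map.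
- by move=> s s' _ IH k; apply: PRElam.
- by move=> s s' ts _ IH k; apply: PREfun.
- by move=> s t t' ts _ IH k; apply: PREarg.
- by move=> s k; apply: PRErefl.
- by move=> s t _ IH k; apply: PREsym.
- by move=> s t u _ IH1 _ IH2 k; apply: PREtrans (IH2 k).
Qed.

Lemma shift_pi k s : shift k (\pi_res s) = \pi_res (preshift k s).
Proof.
apply/eqmodP/asboolP/preshift_eq/asboolP.
by move: (reprK (\pi_res s)) => /eqmodP.
Qed.

(* lsubst k t ss u: u is obtained from t by replacing bijectively the
   occurrences of the index k by the elements of the bag ss, and removing k
   from the indices.  lsubst_bag does the same for the bag ts, producing us,
   the elements of ss being distributed among those of ts. *)
Inductive lsubst : nat -> res -> seq res -> res -> Prop :=
| LSvar k s : lsubst k (RVar k) [:: s] s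
| LSvar_neq k i : i != k -> lsubst k (RVar i) [::] (RVar (unbump k i))
| LSlam k t ss u : lsubst k.+1 t (map (shift 0) ss) u ->
    lsubst k (RLam t) ss (RLam u)
| LSapp k t ts ss ss1 ss2 u us :
    lsubst k t ss1 u -> lsubst_bag k ts ss2 us -> perm_eq ss (ss1 ++ ss2) ->
    lsubst k (RApp t ts) ss (RApp u us)
with lsubst_bag : nat -> seq res -> seq res -> seq res -> Prop :=
| LSnil k : lsubst_bag k [::] [::] [::]
| LScons k t ts ss1 ss2 u us :
    lsubst k t ss1 u -> lsubst_bag k ts ss2 us ->
    lsubst_bag k (t :: ts) (ss1 ++ ss2) (u :: us).

(* e<a^!/x> where e is a set of bodies of abstractions over x: in the elements
   of e, x is the index 0 and any other variable i is the index i + 1. *)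
Definition subst_set (e a : set res) : set res :=
  \bigcup_(t in e) \bigcup_(ss in bang a) lsubst 0 t ss.

(* Structures *)

Definition structure := set (set res).

Definition arr (S S' : structure) : structure :=
  [set f | forall a, S a -> S' (app_set f a)].

(* e is a set of bodies of abstractions; e<{x}^!/_> is e with the bound
   variable named x.  That name being immaterial, "e belongs to S" is required
   under every name x.  A set lam_set e may thus have all the variables free,
   each of its elements being alpha-converted on its own.  This matters: with a
   single name x for all the elements of e, x is not free in {lambda x.s | s in
   e}, so that saturation says nothing of {lambda y.t | t in a} when a in S has
   all the variables free (y being fresh for each t separately), and there are
   adapted structures without {lambda x.lambda y.x}. *)
Definition saturated (S S' : structure) : Prop :=
  forall (e f0 : set res) (fs : seq (set res)),
    (forall x : var, S (subst_set e [set RVar x])) ->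
    S f0 -> List.Forall S fs ->
    S' (apps_set (subst_set e f0) fs) ->
    S' (apps_set (app_set (lam_set e) f0) fs).

Definition neutral (S : structure) : structure :=
  [set a | exists x : var, a = [set RVar x]] `|`
  [set a | exists (x : var) (b : set res) (bs : seq (set res)),
     List.Forall S (b :: bs) /\ a = apps_set [set RVar x] (b :: bs)].

Definition adapted (S : structure) : Prop :=
  [/\ saturated S S,
      [/\ neutral S `<=` arr S (neutral S),
          arr S (neutral S) `<=` arr (neutral S) S
        & arr (neutral S) S `<=` S]
    & forall b b', S b -> S b' -> S (b `|` b')].

(* Main.v *)
(* Reducibility: a type A is interpreted by a structure interp S A with
   N(S) <= interp S A <= S which is S-saturated and closed under unions, and
   T(M) with elements of interp S A_i substituted for the variables x_i : A_i
   belongs to interp S B whenever M : B.  Taking the {x_i}, which are neutral,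
   for these elements gives the theorem.  Substitution of sets is carried out
   along M, simultaneously for all the variables, so that it commutes with all
   the term constructors; for an abstraction, saturation then requires that
   substituting under the binder first, and for the bound variable next, is the
   same as doing both simultaneously. *)
Require Import Defs.
From mathcomp Require Import all_boot.
From mathcomp Require Import generic_quotient.
From mathcomp Require Import boolp classical_sets.
From mathcomp Require Import zify.
From Stdlib Require List.

Set Implicit Arguments.
Unset Strict Implicit.
Unset Printing Implicit Defensive.

Local Open Scope quotient_scope.
Local Open Scope classical_set_scope.

(** * Resource terms *)

Lemma res_eqP (s t : preres) : \pi_res s = \pi_res t <-> preres_eq s t.
Proof. by split=> [/eqmodP/asboolP|H]; [|apply/eqmodP/asboolP]. Qed.

(** Permutations of a bag and rewriting inside its elements interleave in [preres_eq]. Permuting the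
    classes of the elements absorbs both, and this invariant is stable under symmetry and
    transitivity. Injectivity and disjointness of the constructors of [res] follow. *)
Lemma preres_eq_inv s t : preres_eq s t ->
  match s, t with
  | PRVar i, PRVar j => i = j
  | PRLam s, PRLam t => preres_eq s t
  | PRApp s ss, PRApp t ts =>
      preres_eq s t /\ perm_eq (map \pi_res ss) (map \pi_res ts)
  | _, _ => False
  end.
Proof.
elim=> {s t}.
- by move=> s ts ts' p; split; [exact: PRErefl|exact: perm_map].
- by [].
- by move=> s s' ts H _; split.
- move=> s t t' ts /res_eqP H _ /=; split; first exact: PRErefl.
  by rewrite H.
- by case=> //= *; [exact: PRErefl|split=> //; exact: PRErefl].
- case=> [i|s|s ss] [j|t|t ts] // _; first exact: PREsym.
  by move=> [/PREsym H]; rewrite perm_sym.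
- case=> [i|s|s ss] [j|t|t ts] [k|u|u us] //= _ H1 _ H2.
  + by rewrite H1.
  + exact: PREtrans H1 H2.
  + case: H1 H2 => [H1 p1] [H2 p2]; split; first exact: PREtrans H1 H2.
    exact: perm_trans p1 p2.
Qed.

Lemma map_pi_repr (ts : seq res) : map \pi_res (map repr ts) = ts.
Proof. by rewrite -map_comp map_id_in // => t _ /=; rewrite reprK. Qed.

Lemma RVar_inj : injective RVar.
Proof. by move=> i j /res_eqP/preres_eq_inv. Qed.

Lemma RLam_inj : injective RLam.
Proof. by move=> s t /res_eqP/preres_eq_inv/res_eqP; rewrite !reprK. Qed.

Lemma RApp_inj s ss t ts :
  RApp s ss = RApp t ts -> s = t /\ perm_eq ss ts.
Proof.
by move=> /res_eqP/preres_eq_inv[/res_eqP]; rewrite !reprK !map_pi_repr.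
Qed.

Lemma RVar_neq_RLam i t : RVar i <> RLam t.
Proof. by move=> /res_eqP/preres_eq_inv. Qed.

Lemma RVar_neq_RApp i t ts : RVar i <> RApp t ts.
Proof. by move=> /res_eqP/preres_eq_inv. Qed.

Lemma RLam_neq_RApp s t ts : RLam s <> RApp t ts.
Proof. by move=> /res_eqP/preres_eq_inv. Qed.

(** The type [res] being a quotient, the induction runs on a representative; [RLam_pi] and [RApp_pi]
    carry each clause back to classes. *)
Lemma res_ind (P : res -> Prop) :
  (forall i, P (RVar i)) ->
  (forall t, P t -> P (RLam t)) ->
  (forall t ts, P t -> List.Forall P ts -> P (RApp t ts)) ->
  forall t, P t.
Proof.
move=> Pvar Plam Papp t; rewrite -[t]reprK.
move: (repr t); fix IH 1; case=> [i|s|s ts].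
- exact: Pvar.
- by rewrite -RLam_pi; apply: Plam.
- rewrite -RApp_pi; apply: Papp => //.
  (* The induction on the bag is nested inside the [fix], so that [IH] is applied only to elements
     of the bag. *)
  by elim: ts => [|u ts IHts] /=; constructor.
Qed.

Lemma shift_var k i : shift k (RVar i) = RVar (bump k i).
Proof. exact: shift_pi. Qed.

Lemma shift_lam k t : shift k (RLam t) = RLam (shift k.+1 t).
Proof. by rewrite shift_pi -RLam_pi. Qed.

Lemma shift_app k t ts :
  shift k (RApp t ts) = RApp (shift k t) (map (shift k) ts).
Proof. by rewrite shift_pi /= -RApp_pi -!map_comp. Qed.

Lemma map_eq_Forall (f g : res -> res) ts :
  List.Forall (fun t => f t = g t) ts -> map f ts = map g ts.
Proof. by elim=> //= t {}ts -> _ ->. Qed.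

Lemma shift_shift i j t : i <= j ->
  shift i (shift j t) = shift j.+1 (shift i t).
Proof.
elim/res_ind: t i j => [n|t IH|t ts IH IHs] i j ij.
- by rewrite !shift_var /bump; congr RVar; lia.
- by rewrite !shift_lam IH.
- rewrite !shift_app IH // -!map_comp; congr RApp.
  by apply/map_eq_Forall/List.Forall_impl/IHs => u /(_ i j ij).
Qed.

(** * Substitution of sets *)

(** Needed because an equality of applications in [res] determines the bag only up to the order of
    its enumeration. *)
Lemma Forall2_perm (R : res -> res -> Prop) ts ts' us :
  perm_eq ts ts' -> List.Forall2 R ts us ->
  exists2 us', perm_eq us us' & List.Forall2 R ts' us'.
Proof.
have swap (x : res) s1 s2 : perm_eq (s1 ++ x :: s2) (x :: s1 ++ s2).
  exact/permPl/(perm_catCA s1 [:: x] s2).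
move=> p H; elim: H ts' p => [|t u {}ts {}us tu _ IH] ts' p.
  by exists [::] => //; rewrite perm_sym in p; rewrite (perm_nilP p).
have tts' : t \in ts' by rewrite -(perm_mem p) mem_head.
case/splitPr: tts' p => p1 p2 p.
have /IH[us' pus] : perm_eq ts (p1 ++ p2).
  by rewrite -(perm_cons t) (permPl p).
move=> /List.Forall2_app_inv_l[u1 [u2 [H1 [H2 e]]]].
(* The concatenation of the standard library is reread as the convertible [cat]. *)
have {}e : us' = u1 ++ u2 by [].
exists (u1 ++ u :: u2).
  by rewrite perm_sym (permPl (swap _ _ _)) perm_cons perm_sym -e.
by apply: List.Forall2_app => //; constructor.
Qed.

Lemma bang_image (f : res -> res) a ss :
  bang (f @` a) ss <-> exists2 ss', bang a ss' & ss = map f ss'.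
Proof.
split=> [|[ss' ass' ->]].
- elim=> [|s {}ss [t at' <-] _ [ts ats ->]]; first by exists [::].
  by exists (t :: ts) => //; constructor.
- by elim: ass' => [|s {}ss' as' _ IH] /=; constructor=> //; exists s.
Qed.

Lemma bang_cat a ss ts : bang a (ss ++ ts) <-> bang a ss /\ bang a ts.
Proof. exact: List.Forall_app. Qed.

Lemma bang_perm a ss ts : perm_eq ss ts -> bang a ss -> bang a ts.
Proof.
move=> p; have bangE us : bang a us <-> forall u, u \in us -> a u.
  split.
    by elim=> // x {}us ax _ IH u; rewrite in_cons => /orP[/eqP->|/IH].
  elim: us => [|x us IH] H; constructor; first exact/H/mem_head.
  by apply: IH => u uus; apply: H; rewrite in_cons uus orbT.
by move=> /bangE H; apply/bangE => u; rewrite -(perm_mem p); apply: H.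
Qed.

(* The elements of t<a^!/k>. *)
Definition lsets (k : nat) (a : set res) (t : res) : set res :=
  \bigcup_(ss in bang a) lsubst k t ss.

Lemma lsets_var_eq k a : lsets k a (RVar k) = a.
Proof.
apply/seteqP; split=> u; last first.
  by move=> au; exists [:: u]; [constructor|exact: LSvar].
(* [RVar k] is a class and not a constructor, so it is generalized before the case analysis;
   injectivity and disjointness then settle the equations. *)
move=> [ss ass H]; move e: (RVar k) H => t H.
case: H ass e => {t ss u k}.
- by move=> k s H _; inversion H.
- by move=> k i /eqP ik _ /RVar_inj/esym.
- by move=> k t ss u _ _ /RVar_neq_RLam.
- by move=> k t ts ss ss1 ss2 u us _ _ _ _ /RVar_neq_RApp.
Qed.

Lemma lsets_var_neq k a i : i != k ->
  lsets k a (RVar i) = [set RVar (unbump k i)].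
Proof.
move=> ik; apply/seteqP; split=> u; last first.
  by move=> ->; exists [::]; [constructor|exact: LSvar_neq].
move=> [ss _ H]; move e: (RVar i) H => t H.
case: H ik e => {t ss u k}.
- by move=> k s /eqP + /RVar_inj.
- by move=> k j _ _ /RVar_inj ->.
- by move=> k t ss u _ _ /RVar_neq_RLam.
- by move=> k t ts ss ss1 ss2 u us _ _ _ _ /RVar_neq_RApp.
Qed.

Lemma lsets_lam k a t :
  lsets k a (RLam t) = lam_set (lsets k.+1 (shift 0 @` a) t).
Proof.
apply/seteqP; split=> u; last first.
  move=> [{}u [ss /bang_image[ss' ass' ->] H] <-].
  by exists ss' => //; exact: LSlam.
move=> [ss ass H]; move e: (RLam t) H => t' H.
case: H ass e => {t' ss u k}.
- by move=> k s _ /esym/RVar_neq_RLam.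
- by move=> k i _ _ /esym/RVar_neq_RLam.
- move=> k t' ss u H ass /RLam_inj ->; exists u => //.
  by exists (map (shift 0) ss) => //; apply/bang_image; exists ss.
- by move=> k t' ts ss ss1 ss2 u us _ _ _ _ /RLam_neq_RApp.
Qed.

Lemma lsets_bagP k a ts us :
  (exists2 ss, bang a ss & lsubst_bag k ts ss us) <->
  List.Forall2 (lsets k a) ts us.
Proof.
split=> [[ss ass H]|].
- elim: ts ss us ass H => [|t ts IH] ss us ass H; inversion H; subst=> //.
  move: ass => /bang_cat[ass1 ass2].
  by constructor; [exists ss1|exact: IH ass2 _].
- elim=> [|t u {}ts {}us [ss1 ass1 tu] _ [ss2 ass2 tsus]].
    by exists [::]; [constructor|exact: LSnil].
  by exists (ss1 ++ ss2); [apply/bang_cat|exact: LScons].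
Qed.

(** Letting the bag range over all of [bang a] removes the bookkeeping of linearity: [bang a] is
    stable under concatenation, splitting and permutation, so the function and each argument draw
    their bags independently. *)
Lemma lsets_app k a t ts :
  lsets k a (RApp t ts) =
  [set RApp u us | u in lsets k a t & us in List.Forall2 (lsets k a) ts].
Proof.
apply/seteqP; split=> u; last first.
  move=> [{}u [ss1 ass1 tu]] [us /lsets_bagP[ss2 ass2 tsus]] <-.
  exists (ss1 ++ ss2); first exact/bang_cat.
  exact: LSapp tu tsus (perm_refl _).
move=> [ss ass H]; move e: (RApp t ts) H => t' H.
case: H ass e => {t' ss u k}.
- by move=> k s _ /esym/RVar_neq_RApp.
- by move=> k i _ _ /esym/RVar_neq_RApp.
- by move=> k t' ss u _ _ /esym/RLam_neq_RApp.
- move=> k t' ts' ss ss1 ss2 u us tu tsus pss ass /RApp_inj[-> pts].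
  have /bang_cat[ass1 ass2] := bang_perm pss ass.
  have /lsets_bagP : exists2 ss, bang a ss & lsubst_bag k ts' ss us.
    by exists ss2.
  (* The derivation may enumerate the bag as [ts'], a permutation of [ts]; the results are reordered
     accordingly, which [RApp] does not see. *)
  move=> /(Forall2_perm _)-/(_ ts); rewrite perm_sym pts => -[//|us' pus Hus].
  by exists u; [exists ss1|exists us' => //; exact/esym/RApp_perm].
Qed.

(** The index [k] does not occur in [shift k t]: only the empty bag contributes, and removing [k]
    from the indices undoes the shift. *)
Lemma lsets_shift_id k a t : lsets k a (shift k t) = [set t].
Proof.
elim/res_ind: t k a => [i|t IH|t ts IH IHs] k a.
- by rewrite shift_var lsets_var_neq ?bumpK // eq_sym neq_bump.
- by rewrite shift_lam lsets_lam IH /lam_set image_set1.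
- rewrite shift_app lsets_app IH.
  have -> : List.Forall2 (lsets k a) (map (shift k) ts) = [set ts].
    elim: IHs => [|s {}ts Hs _ IHs] /=; apply/seteqP; split=> us.
    + by move=> H; inversion H.
    + by move=> ->; constructor.
    + move=> H; inversion H; subst; move: H2 H4.
      by rewrite Hs IHs => -> ->.
    + by move=> ->; constructor; rewrite ?Hs ?IHs.
  apply/seteqP; split=> u; first by move=> [_ -> [_ -> <-]].
  by move=> ->; exists t => //; exists ts.
Qed.

Lemma image_shift_shift j a :
  shift 0 @` (shift j @` a) = shift j.+1 @` (shift 0 @` a).
Proof.
rewrite !image_comp; apply: eq_imagel => t _ /=; exact: shift_shift.
Qed.

Lemma lsets_shift j k a t : j <= k ->
  lsets k.+1 (shift j @` a) (shift j t) = shift j @` lsets k a t.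
Proof.
elim/res_ind: t j k a => [i|t IH|t ts IH IHs] j k a jk.
- rewrite shift_var; have [->|ik] := eqVneq i k.
    by rewrite /bump jk add1n !lsets_var_eq.
  rewrite !lsets_var_neq // ?image_set1 ?shift_var.
    by rewrite /bump /unbump; congr [set RVar _]; lia.
  by rewrite /bump; lia.
- rewrite shift_lam !lsets_lam image_shift_shift IH //.
  rewrite /lam_set !image_comp; apply: eq_imagel => u _ /=.
  by rewrite shift_lam.
- rewrite shift_app !lsets_app IH //.
  have -> : List.Forall2 (lsets k.+1 (shift j @` a)) (map (shift j) ts) =
            map (shift j) @` List.Forall2 (lsets k a) ts.
    elim: IHs => [|s {}ts Hs _ IHs] /=; apply/seteqP; split=> us.
    + by move=> H; inversion H; exists [::].
    + by move=> [vs H <-]; inversion H; constructor.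
    + move=> H; inversion H; subst; move: H2 H4.
      rewrite Hs // IHs => -[v sv <-] [vs tsvs <-].
      by exists (v :: vs) => //; constructor.
    + move=> [vs H <-]; inversion H; subst.
      constructor; first by rewrite Hs //; exists y.
      by rewrite IHs; exists l'.
  apply/seteqP; split=> u.
    move=> [_ [v tv <-] [_ [vs tsvs <-] <-]].
    exists (RApp v vs); last exact: shift_app.
    by exists v => //; exists vs.
  move=> [_ [v tv [vs tsvs <-]] <-]; rewrite shift_app.
  by exists (shift j v); [exists v|exists (map (shift j) vs) => //; exists vs].
Qed.

(** * Substitution into sets of resource terms *)

Definition lsubst_set (k : nat) (e a : set res) : set res :=
  \bigcup_(t in e) lsets k a t.

Lemma lsubst_set_lam k e a :
  lsubst_set k (lam_set e) a = lam_set (lsubst_set k.+1 e (shift 0 @` a)).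
Proof.
apply/seteqP; split=> u.
  move=> [_ [t et <-]]; rewrite lsets_lam => -[v tv <-].
  by exists v => //; exists t.
move=> [v [t et tv] <-]; exists (RLam t); first by exists t.
by rewrite lsets_lam; exists v.
Qed.

Lemma bang_lsubst_set k e a us :
  bang (lsubst_set k e a) us <->
  exists2 ts, bang e ts & List.Forall2 (lsets k a) ts us.
Proof.
split=> [|[ts + H]].
- elim=> [|u {}us [t et tu] _ [ts ets tsus]].
    by exists [::]; constructor.
  by exists (t :: ts); constructor.
- elim: H => [|t u {}ts {}us tu _ IH] ets; first by constructor.
  by inversion ets; subst; constructor; [exists t|exact: IH].
Qed.

(** Each element of a bag over the substituted [b] comes from its own term of [b] with its own bag
    over [a], and these choices can be gathered into one bag over [a]. *)
Lemma lsubst_set_app k f b a :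
  lsubst_set k (app_set f b) a =
  app_set (lsubst_set k f a) (lsubst_set k b a).
Proof.
apply/seteqP; split=> u.
  move=> [_ [t ft [ts bts <-]]]; rewrite lsets_app => -[v tv [vs tsvs <-]].
  exists v; first by exists t.
  by exists vs => //; apply/bang_lsubst_set; exists ts.
move=> [v [t ft tv] [vs /bang_lsubst_set[ts bts tsvs] <-]].
exists (RApp t ts); first by exists t => //; exists ts.
by rewrite lsets_app; exists v => //; exists vs.
Qed.

Lemma lsubst_set1 k t a : lsubst_set k [set t] a = lsets k a t.
Proof. exact: bigcup_set1. Qed.

Lemma lsubst_set_shift_id k e a : lsubst_set k (shift k @` e) a = e.
Proof.
rewrite /lsubst_set bigcup_image.
under eq_bigcupr do rewrite lsets_shift_id.
by rewrite bigcup_imset1 image_id.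
Qed.

Lemma lsubst_set_shift j k e a : j <= k ->
  lsubst_set k.+1 (shift j @` e) (shift j @` a) = shift j @` lsubst_set k e a.
Proof.
move=> jk; rewrite /lsubst_set bigcup_image image_bigcup.
by apply: eq_bigcupr => t _; rewrite lsets_shift.
Qed.

Lemma lsubst_setU k e e' a :
  lsubst_set k (e `|` e') a = lsubst_set k e a `|` lsubst_set k e' a.
Proof. exact: bigcup_setU. Qed.

(** * Simultaneous substitution of sets along non-deterministic terms *)

Definition scons (a : set res) (rho : var -> set res) (x : var) : set res :=
  if x is y.+1 then rho y else a.

Definition up (rho : var -> set res) : var -> set res :=
  scons [set RVar 0] (fun x => shift 0 @` rho x).

Fixpoint presubst (rho : var -> set res) (M : preterm) : set res :=
  match M with
  | PVar x => rho x
  | PLam M => lam_set (presubst (up rho) M)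
  | PApp M N => app_set (presubst rho M) (presubst rho N)
  | PAdd M N => presubst rho M `|` presubst rho N
  end.

Lemma app_setUl f g a : app_set (f `|` g) a = app_set f a `|` app_set g a.
Proof.
apply/seteqP; split=> t.
  by move=> [s [fs|gs] [ts tsa <-]]; [left|right]; exists s => //; exists ts.
by move=> [] [s fs [ts tsa <-]]; exists s; [left| |right|] => //; exists ts.
Qed.

(** The identities on terms hold because abstraction, and application in function position,
    distribute over unions. The environment is kept general, as it changes under a binder. *)
Lemma presubst_eq rho M N :
  preterm_eq M N -> presubst rho M = presubst rho N.
Proof.
move=> MN; elim: MN rho => //= {M N}.
- by move=> M N rho; rewrite setUC.
- by move=> M N P rho; rewrite setUA.
- by move=> M N rho; rewrite /lam_set image_setU.
- by move=> M N P rho; rewrite app_setUl.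
- by move=> M M' _ IH rho; rewrite IH.
- by move=> M M' N N' _ IHM _ IHN rho; rewrite IHM IHN.
- by move=> M M' N N' _ IHM _ IHN rho; rewrite IHM IHN.
- by move=> M N P _ IHM _ IHN rho; rewrite IHM IHN.
Qed.

Lemma presubst_id M : presubst (fun x => [set RVar x]) M = pretaylor M.
Proof.
elim: M => //= [M <-|M -> N ->|M -> N ->] //.
congr (lam_set (presubst _ M)); apply: funext => -[|x] //=.
by rewrite image_set1 shift_var.
Qed.

(** The pointwise hypothesis survives the passage under a binder: [up rho] and [up rho'] satisfy it
    at index [k.+1] with [a] shifted, by [lsubst_set_shift]. *)
Lemma lsubst_set_presubst k a rho rho' M :
  (forall x, lsubst_set k (rho x) a = rho' x) ->
  lsubst_set k (presubst rho M) a = presubst rho' M.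
Proof.
elim: M k a rho rho' => [x|M IH|M IHM N IHN|M IHM N IHN] k a rho rho' H /=.
- exact: H.
- rewrite lsubst_set_lam; congr lam_set; apply: IH => -[|x] /=.
    by rewrite lsubst_set1 lsets_var_neq.
  by rewrite lsubst_set_shift // H.
- by rewrite lsubst_set_app (IHM _ _ _ _ H) (IHN _ _ _ _ H).
- by rewrite lsubst_setU (IHM _ _ _ _ H) (IHN _ _ _ _ H).
Qed.

Lemma subst_set_presubst_up a rho M :
  subst_set (presubst (up rho) M) a = presubst (scons a rho) M.
Proof.
(* Index 0 receives [a]; the images of the other variables were shifted by [up], and the
   substitution at 0 brings them back. *)
apply: lsubst_set_presubst => -[|x] /=.
  by rewrite lsubst_set1 lsets_var_eq.
exact: lsubst_set_shift_id.
Qed.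

Definition tsubst (rho : var -> set res) (M : term) : set res :=
  presubst rho (repr M).

Lemma tsubst_pi rho M : tsubst rho (\pi_term M) = presubst rho M.
Proof.
by apply/presubst_eq/asboolP; move: (reprK (\pi_term M)) => /eqmodP.
Qed.

Lemma tsubst_var rho x : tsubst rho (TVar x) = rho x.
Proof. exact: tsubst_pi. Qed.

Lemma tsubst_lam rho M : tsubst rho (TLam M) = lam_set (tsubst (up rho) M).
Proof. exact: tsubst_pi. Qed.

Lemma tsubst_app rho M N :
  tsubst rho (TApp M N) = app_set (tsubst rho M) (tsubst rho N).
Proof. exact: tsubst_pi. Qed.

Lemma tsubst_add rho M N :
  tsubst rho (TAdd M N) = tsubst rho M `|` tsubst rho N.
Proof. exact: tsubst_pi. Qed.

(** * Reducibility *)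

Fixpoint interp (S : structure) (A : ty) : structure :=
  match A with
  | TyAtom _ => S
  | TyArr A B => arr (interp S A) (interp S B)
  | TyCap A B => interp S A `&` interp S B
  end.

Lemma arr_subset (S S' T T' : structure) :
  S' `<=` S -> T `<=` T' -> arr S T `<=` arr S' T'.
Proof. by move=> S'S TT' f fST a S'a; apply/TT'/fST/S'S. Qed.

(** The two inclusions are proved together because the arrow is contravariant: its lower bound uses
    the upper bound of the domain, and its upper bound the lower bound of the domain. *)
Lemma interp_bounds S A :
  adapted S -> neutral S `<=` interp S A /\ interp S A `<=` S.
Proof.
move=> [_ [N_arr arr_arr arr_S] _].
have NS : neutral S `<=` S.
  exact: subset_trans N_arr (subset_trans arr_arr arr_S).
elim: A => [_|A [NA AS] B [NB BS]|A [NA AS] B [NB BS]] /=.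
- by split.
- split; first exact: subset_trans N_arr (arr_subset AS NB).
  exact: subset_trans (arr_subset NA BS) arr_S.
- by split=> [a Na|a [/AS]] //; split; [exact: NA|exact: NB].
Qed.

Lemma interp_setU S A b b' :
  adapted S -> interp S A b -> interp S A b' -> interp S A (b `|` b').
Proof.
move=> [_ _ SU]; elim: A b b' => [_|A _ B IHB|A IHA B IHB] b b' /=.
- exact: SU.
- by move=> Hb Hb' a Aa; rewrite app_setUl; apply: IHB; [exact: Hb|exact: Hb'].
- by move=> [Ab Bb] [Ab' Bb']; split; [exact: IHA|exact: IHB].
Qed.

(** At an arrow type, the argument [a] joins the end of the list [fs] and saturation of the codomain
    applies to the longer list. *)
Lemma interp_saturated S A : adapted S -> saturated S (interp S A).
Proof.
move=> adS; elim: A => [_|A _ B IHB|A IHA B IHB] /=; first by case: adS.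
- move=> e f0 fs Se Sf0 Sfs H a Aa.
  (* Saturation admits as arguments only elements of [S], whence the appeal to the upper bound. *)
  have Sa : S a by apply: (interp_bounds A adS).2.
  have appsE g : app_set (apps_set g fs) a = apps_set g (fs ++ [:: a]).
    by rewrite /apps_set foldl_cat.
  rewrite appsE; apply: IHB => //; last by rewrite -appsE; apply: H.
  by apply/List.Forall_app; split=> //; constructor.
- by move=> e f0 fs Se Sf0 Sfs [HA HB]; split; [exact: IHA|exact: IHB].
Qed.

Lemma interp_subty S A B : subty A B -> interp S A `<=` interp S B.
Proof.
elim=> {A B} /=.
- by move=> A a.
- by move=> A B C _ AB _ BC; apply: subset_trans BC.
- by move=> A B a [].
- by move=> A B a [].
- by move=> A A' B B' _ A'A _ BB'; apply: arr_subset.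
- by move=> A B C f [fB fC] a Aa; split; [exact: fB|exact: fC].
Qed.

Lemma interp_typing S G M B rho :
  adapted S -> typing G M B ->
  (forall x A, onth G x = Some A -> interp S A (rho x)) ->
  interp S B (tsubst rho M).
Proof.
move=> adS MB; elim: MB rho => {G M B}.
- by move=> G x A GxA rho Hrho; rewrite tsubst_var; apply: Hrho.
- move=> G M A B _ IH rho Hrho a Aa.
  (* Used twice: with the neutral [{x}] for [b], it puts the body in [S] under every name of the
     bound variable; with [a], it gives the contracted redex that saturation expands. *)
  have body b : interp S A b ->
      interp S B (subst_set (tsubst (up rho) M) b).
    by move=> Ab; rewrite subst_set_presubst_up; apply: IH => -[_ [<-]|].
  have [NA AS] := interp_bounds A adS; have [_ BS] := interp_bounds B adS.
  rewrite tsubst_lam; apply: (@interp_saturated S B adS _ a [::]) => //.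
  + by move=> x; apply/BS/body/NA; left; exists x.
  + exact: AS.
  + exact: body.
- move=> G M N A B _ IHM _ IHN rho Hrho; rewrite tsubst_app.
  by apply: IHM => //; exact: IHN.
- by move=> G M A B _ IHA _ IHB rho Hrho; split; [exact: IHA|exact: IHB].
- move=> G M N A _ IHM _ IHN rho Hrho; rewrite tsubst_add.
  by apply: interp_setU => //; [exact: IHM|exact: IHN].
- by move=> G M A A' _ IH AA' rho Hrho; apply/(interp_subty AA')/IH.
Qed.

Theorem theorem4 (S : structure) (M : term) :
  adapted S -> typable M -> S (taylor M).
Proof.
move=> adS [G [B MB]].
(* The Taylor support is the substitution of [{x}] for each variable [x], to which [interp_typing]
   applies. *)
rewrite /taylor -presubst_id; apply: (interp_bounds B adS).2.
apply: (interp_typing adS MB) => x A _.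
by apply: (interp_bounds A adS).1; left; exists x.
Qed.
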